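(* Let $q,d\geq2$ and $\iota\geq1$ be integers and let $1>x>1-\frac{2}{(d+1)\iota}$. Write $\xi=x-\left(1-\frac{2}{(d+1)\iota}\right)$ and let $\delta>0$. Let $G=(V,E)$ be a graph and $\mathcal{C}$ an even generating set of $\mathcal{F}_q(G)$ of size $r$ satisfying $d(\mathcal{C})\leq d$ and $\iota(\mathcal{C})\leq \iota$. Then the $\delta$-mixing time of the flow Markov chain for $(G,\mathcal{C})$ with parameter $x$ is at most $\frac{4r}{d\iota}\log(r \delta^{-1})\xi^{-1}$.
   Context: Graphs are finite multigraphs with a fixed orientation. $\mathcal{F}_q(G)$ is the set of $\mathbb{Z}_q$-flows $f:E\to\mathbb{Z}_q$ (inflow equals outflow in $\mathbb{Z}_q$ at every vertex); $\supp(f)=\{e:f(e)\ne0\}$. For an even subgraph $C$, choose an Eulerian orientation of each component and let $\chi_C(e)=0$ for $e\notin C$, $\chi_C(e)=\pm1$ for $e\in C$ according to agreement with $G$'s orientation. An even generating set of $\mathcal{F}_q(G)$ is a set $\mathcal{C}$ of even subgraphs whose $\chi_C$ (mod $q$) generate $\mathcal{F}_q(G)$ as a $\mathbb{Z}_q$-module. $d(\mathcal{C})=\max_C|\{D\in\mathcal{C}\setminus\{C\}:C\cap D\neq\emptyset\}|$, $\iota(\mathcal{C})=\max_{C_1\ne C_2}|C_1\cap C_2|$. $\mu_{\mathrm{flow}}(f)=x^{|\supp(f)|}/\sum_{g\in\mathcal{F}_q(G)}x^{|\supp(g)|}$. The flow Markov chain on $\mathcal{F}_q(G)$ has transitions,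 for $f\in\mathcal{F}_q(G)$, $t\in\mathbb{Z}_q\setminus\{0\}$, $C\in\mathcal{C}$: $P(f,f+t\chi_C)=\frac1r\frac{\mu_{\mathrm{flow}}(f+t\chi_C)}{\sum_{u\in\mathbb{Z}_q}\mu_{\mathrm{flow}}(f+u\chi_C)}$, $P(f,f)=\frac1r\sum_{C\in\mathcal{C}}\frac{\mu_{\mathrm{flow}}(f)}{\sum_{u\in\mathbb{Z}_q}\mu_{\mathrm{flow}}(f+u\chi_C)}$, all others zero (i.e., choose $C$ uniformly and resample its coefficient proportional to $\mu_{\mathrm{flow}}$); its stationary distribution is $\mu_{\mathrm{flow}}$. The $\delta$-mixing time is the smallest $t$ such that the distribution after $t$ steps is within total variation distance $\delta$ of the stationary distribution (from any start).
   Formalization: The stated bound T fails in degenerate cases (δ>r makes T negative; r=1 with δ near 1 fails by integer rounding; r=0 leaves log undefined), so it is proved when δ≤r and (r≥2 or δ≤1/2), and in all cases the mixing time is shown to be at most max(1,T). *)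

(* Defs.v *)
From mathcomp Require Import all_boot all_order all_algebra.
From mathcomp Require Import reals exp.

Set Implicit Arguments.
Unset Strict Implicit.
Unset Printing Implicit Defensive.

Import Order.TTheory GRing.Theory Num.Theory.
Local Open Scope ring_scope.

(* Loops and parallel edges are allowed; the fixed orientation of an edge is
   from [tail] to [head]. *)
Record multigraph := Multigraph {
  vertex : finType;
  edge : finType;
  tail : edge -> vertex;
  head : edge -> vertex }.

Definition is_flow (G : multigraph) (q : nat) (f : {ffun edge G -> 'Z_q}) : bool :=
  [forall v, \sum_(e | head e == v) f e == \sum_(e | tail e == v) f e].

Definition flow (G : multigraph) (q : nat) : Type :=
  {f : {ffun edge G -> 'Z_q} | is_flow f}.

Definition supp (G : multigraph) (q : nat) (f : {ffun edge G -> 'Z_q}) :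
    {set edge G} :=
  [set e | f e != 0].

(* Subgraphs are identified with their edge sets; a loop counts twice in the
   degree of its vertex. *)
Definition subdeg (G : multigraph) (C : {set edge G}) (v : vertex G) : nat :=
  (#|[set e in C | tail e == v]| + #|[set e in C | head e == v]|)%N.

Definition even_subgraph (G : multigraph) (C : {set edge G}) : Prop :=
  forall v, ~~ odd (subdeg C v).

(* An orientation of C is encoded by o : edge G -> bool, where [o e] says
   whether the orientation of e agrees with that of G; the values of o outside
   C are irrelevant. *)
Definition eulerian_orientation (G : multigraph) (C : {set edge G})
    (o : edge G -> bool) : Prop :=
  forall v,
    #|[set e in C | (if o e then head e else tail e) == v]| =
    #|[set e in C | (if o e then tail e else head e) == v]|.

Definition chi (G : multigraph) (C : {set edge G}) (o : edge G -> bool)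
    (e : edge G) : int :=
  if e \in C then (if o e then 1 else -1) else 0.

(* f + t * chi_C, with chi_C reduced mod q *)
Definition shift (G : multigraph) (q : nat) (o : {set edge G} -> edge G -> bool)
    (f : {ffun edge G -> 'Z_q}) (t : 'Z_q) (C : {set edge G}) :
    {ffun edge G -> 'Z_q} :=
  [ffun e => f e + t * (chi C (o C) e)%:~R].

Definition even_generating_set (G : multigraph) (q : nat)
    (o : {set edge G} -> edge G -> bool) (CC : {set {set edge G}}) : Prop :=
  (forall C, C \in CC -> even_subgraph C) /\
  (forall f : {ffun edge G -> 'Z_q},
     is_flow f <->
     exists c : {set edge G} -> 'Z_q,
       forall e, f e = \sum_(C in CC) c C * (chi C (o C) e)%:~R).

Definition gs_degree (G : multigraph) (CC : {set {set edge G}}) : nat :=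
  \max_(C in CC) #|[set D in CC :\ C | C :&: D != set0]|.

Definition gs_inter (G : multigraph) (CC : {set {set edge G}}) : nat :=
  \max_(C1 in CC) \max_(C2 in CC | C1 != C2) #|C1 :&: C2|.

Definition mu_flow (R : realType) (G : multigraph) (q : nat) (x : R)
    (f : {ffun edge G -> 'Z_q}) : R :=
  x ^+ #|supp f| / \sum_(g : flow G q) x ^+ #|supp (val g)|.

(* Choose C in CC uniformly and resample its coefficient proportionally to
   mu_flow.  The lemmas flow_chain_move, flow_chain_stay and flow_chain_other
   below give the transition probabilities case by case; this form also makes
   sense when the empty subgraph, for which chi_C = 0, belongs to CC. *)
Definition flow_chain (R : realType) (G : multigraph) (q : nat)
    (o : {set edge G} -> edge G -> bool) (CC : {set {set edge G}}) (x : R)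
    (f g : flow G q) : R :=
  (#|CC|%:R)^-1 *
  \sum_(C in CC) \sum_(t : 'Z_q | shift o (val f) t C == val g)
    mu_flow x (shift o (val f) t C) /
      \sum_(u : 'Z_q) mu_flow x (shift o (val f) u C).

Fixpoint nstep (R : realType) (T : finType) (P : T -> T -> R) (n : nat)
    (a b : T) : R :=
  if n is m.+1 then \sum_(c : T) nstep P m a c * P c b else (a == b)%:R.

Definition tv_dist (R : realType) (T : finType) (p p' : T -> R) : R :=
  2^-1 * \sum_(a : T) `|p a - p' a|.

Definition mixed (R : realType) (T : finType) (P : T -> T -> R) (pi : T -> R)
    (delta : R) (n : nat) : Prop :=
  forall a : T, tv_dist (nstep P n a) pi <= delta.

Definition is_mixing_time (R : realType) (T : finType) (P : T -> T -> R)
    (pi : T -> R) (delta : R) (n : nat) : Prop :=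
  mixed P pi delta n /\ forall m, mixed P pi delta m -> (n <= m)%N.

Definition flow_mixing_time (R : realType) (G : multigraph) (q : nat)
    (o : {set edge G} -> edge G -> bool) (CC : {set {set edge G}}) (x delta : R)
    (n : nat) : Prop :=
  is_mixing_time (@flow_chain R G q o CC x) (fun f => mu_flow x (val f)) delta n.

Lemma shift0 (G : multigraph) (q : nat) (o : {set edge G} -> edge G -> bool)
    (f : {ffun edge G -> 'Z_q}) (C : {set edge G}) : shift o f 0 C = f.
Proof. by apply/ffunP=> e; rewrite ffunE mul0r addr0. Qed.

Lemma shift_eqP (G : multigraph) (q : nat) (o : {set edge G} -> edge G -> bool)
    (f : {ffun edge G -> 'Z_q}) (t u : 'Z_q) (C D : {set edge G}) :
  C != set0 -> t != 0 -> shift o f u D = shift o f t C -> D = C /\ u = t.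
Proof.
move=> C0 t0 /ffunP eqs.
have {}eqs e : u * (chi D (o D) e)%:~R = t * (chi C (o C) e)%:~R.
  by have := eqs e; rewrite !ffunE => /addrI.
have chi_neq0 (s : 'Z_q) (A : {set edge G}) e :
    s != 0 -> (s * (chi A (o A) e)%:~R != 0) = (e \in A).
  move=> s0; rewrite /chi; case: ifP => _; last by rewrite mulr0 eqxx.
  by case: ifP => _; rewrite ?mulr1 ?mulrN1 ?oppr_eq0.
have [e0 e0C] := set0Pn _ C0.
have u0 : u != 0.
  apply: contraTneq e0C => uE.
  by rewrite -(chi_neq0 t) // -eqs uE mul0r eqxx.
have DC : D = C by apply/setP=> e; rewrite -(chi_neq0 u) // eqs chi_neq0.
split=> //; move: (eqs e0); rewrite DC /chi e0C.
by case: ifP => _; rewrite ?mulr1 ?mulrN1 // => /oppr_inj.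
Qed.

Lemma flow_chain_move (R : realType) (G : multigraph) (q : nat)
    (o : {set edge G} -> edge G -> bool) (CC : {set {set edge G}}) (x : R)
    (f g : flow G q) (t : 'Z_q) (C : {set edge G}) :
  C \in CC -> C != set0 -> t != 0 -> val g = shift o (val f) t C ->
  flow_chain o CC x f g =
    (#|CC|%:R)^-1 *
    (mu_flow x (val g) / \sum_(u : 'Z_q) mu_flow x (shift o (val f) u C)).
Proof.
move=> CCC C0 t0 gE; rewrite /flow_chain (bigD1 C) //= [X in _ + X]big1.
  rewrite addr0 (big_pred1 t) ?gE // => u /=.
  by apply/eqP/eqP => [/shift_eqP[]|->].
move=> D /andP[_ DC]; rewrite big_pred0 // => u; apply: contraNF DC => /eqP.
by rewrite gE => /shift_eqP[] // ->.
Qed.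

Lemma flow_chain_stay (R : realType) (G : multigraph) (q : nat)
    (o : {set edge G} -> edge G -> bool) (CC : {set {set edge G}}) (x : R)
    (f : flow G q) :
  set0 \notin CC ->
  flow_chain o CC x f f =
    (#|CC|%:R)^-1 *
    \sum_(C in CC)
      mu_flow x (val f) / \sum_(u : 'Z_q) mu_flow x (shift o (val f) u C).
Proof.
move=> CC0; rewrite /flow_chain; congr (_ * _); apply: eq_bigr => C CCC.
have C0 : C != set0 by apply: contraNneq CC0 => <-.
rewrite (big_pred1 0) ?shift0 // => u /=.
apply/eqP/eqP => [uE|->]; last exact: shift0.
apply/eqP; apply: contraT => u0.
have /(shift_eqP C0 u0)[_ uE'] : shift o (val f) 0 C = shift o (val f) u C.
  by rewrite uE shift0.
by rewrite -uE' eqxx in u0.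
Qed.

Lemma flow_chain_other (R : realType) (G : multigraph) (q : nat)
    (o : {set edge G} -> edge G -> bool) (CC : {set {set edge G}}) (x : R)
    (f g : flow G q) :
  (forall t C, C \in CC -> val g <> shift o (val f) t C) ->
  flow_chain o CC x f g = 0.
Proof.
move=> gN; rewrite /flow_chain big1 ?mulr0 // => C CCC.
by rewrite big_pred0 // => t; apply/eqP => /esym; apply: gN.
Qed.

(* Main.v *)
Require Import Defs.
From mathcomp Require Import all_boot all_order all_algebra.
From mathcomp Require Import reals sequences exp.
From mathcomp Require Import lra ring.

(* Path coupling in dual form.  Call a function on flows L-Lipschitz if adding
   a multiple of some chi_C (C in CC) changes it by at most L.  One step of the
   chain maps L-Lipschitz functions to (1 - b) L-Lipschitz ones: for f and
   f + t chi_C, resampling C gives the same law, resampling a D disjoint from C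
   gives laws differing by the same shift t chi_C, and resampling one of the at
   most d other D's costs an extra L (1 - a) / (1 + a), where a = x ^ iota bounds
   the ratios of the weights restricted to D.  Any two flows are joined by at
   most r shifts, so after n steps the total variation distance is at most
   r (1 - b) ^ n. *)

Set Implicit Arguments.
Unset Strict Implicit.
Unset Printing Implicit Defensive.

Import Order.TTheory GRing.Theory Num.Theory.
Local Open Scope ring_scope.

(** * Total variation distance and stationarity for finite chains *)

(** Half the sign of [p - p'] is an optimal test function: its values lie in [-1/2, 1/2], so it
    oscillates by at most 1. *)
Lemma tv_dist_witness (R : realType) (T : finType) (p p' : T -> R) :
  exists h : T -> R, (forall a b, `|h a - h b| <= 1) /\
    tv_dist p p' = \sum_a (p a - p' a) * h a.
Proof.
exists (fun a => Num.sg (p a - p' a) / 2); split=> [a b|].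
  by case: sgrP => _; case: sgrP => _; rewrite ler_norml; apply/andP; split; lra.
rewrite /tv_dist mulr_sumr; apply: eq_bigr => a _.
by rewrite [in LHS]normrEsg; ring.
Qed.

(** By stationarity, the mean of a test function under [pi] is the [pi]-average of its [n]-step
    means over all starting points, so the distance to [pi] is an average of differences between two
    starting points. Only stationarity under [n] steps is asked, which leaves [n = 0] available for
    any kernel. *)
Lemma tv_dist_le_of_osc (R : realType) (T : finType) (P : T -> T -> R)
    (pi : T -> R) (n : nat) (M : R) (a : T) :
  (forall b, 0 <= pi b) -> \sum_b pi b = 1 ->
  (forall b, \sum_c pi c * nstep P n c b = pi b) ->
  (forall h : T -> R, (forall b c, `|h b - h c| <= 1) -> forall b c,
     `|\sum_g nstep P n b g * h g - \sum_g nstep P n c g * h g| <= M) ->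
  tv_dist (nstep P n a) pi <= M.
Proof.
move=> pi0 pi1 piP osc; have [h [h1 ->]] := tv_dist_witness (nstep P n a) pi.
have -> : \sum_g (nstep P n a g - pi g) * h g =
   \sum_b pi b * (\sum_g nstep P n a g * h g - \sum_g nstep P n b g * h g).
  under eq_bigr do rewrite mulrBl.
  under [RHS]eq_bigr do rewrite mulrBr.
  rewrite !big_split /= -mulr_suml pi1 mul1r; congr (_ + _).
  rewrite !sumrN; congr (- _).
  under [RHS]eq_bigr do rewrite mulr_sumr.
  rewrite exchange_big /=; apply: eq_bigr => g _.
  by rewrite -{1}piP mulr_suml; apply: eq_bigr => b _; rewrite mulrA.
rewrite -[leRHS]mul1r -pi1 mulr_suml; apply: ler_sum => b _.
by rewrite ler_wpM2l //; apply: le_trans (ler_norm _) (osc _ h1 _ _).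
Qed.

Lemma nstep0_stationary (R : realType) (T : finType) (P : T -> T -> R)
    (pi : T -> R) (b : T) : \sum_a pi a * nstep P 0 a b = pi b.
Proof.
rewrite (bigD1 b) //= eqxx mulr1 big1 ?addr0 // => a /negPf ->.
by rewrite mulr0.
Qed.

Lemma nstep_stationary (R : realType) (T : finType) (P : T -> T -> R)
    (pi : T -> R) (n : nat) (b : T) :
  (forall c, \sum_a pi a * P a c = pi c) ->
  \sum_a pi a * nstep P n a b = pi b.
Proof.
move=> piP; elim: n b => [|n IHn] b; first exact: nstep0_stationary.
rewrite /=.
under eq_bigr do rewrite mulr_sumr.
rewrite exchange_big /= -{}[RHS]piP; apply: eq_bigr => c _.
by rewrite -IHn mulr_suml; apply: eq_bigr => a _; rewrite mulrA.
Qed.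

Lemma sum_nstepS (R : realType) (T : finType) (P : T -> T -> R) (n : nat)
    (a : T) (h : T -> R) :
  \sum_g nstep P n.+1 a g * h g =
  \sum_c nstep P n a c * \sum_g P c g * h g.
Proof.
under eq_bigr do rewrite /= mulr_suml.
rewrite exchange_big /=; apply: eq_bigr => c _.
by rewrite mulr_sumr; apply: eq_bigr => g _; rewrite mulrA.
Qed.

Lemma sum_nstep0 (R : realType) (T : finType) (P : T -> T -> R) (a : T)
    (h : T -> R) : \sum_g nstep P 0 a g * h g = h a.
Proof.
rewrite (bigD1 a) //= eqxx mul1r big1 ?addr0 // => g.
by rewrite eq_sym => /negPf ->; rewrite mul0r.
Qed.

(** * Weighted means under comparable weights *)

(** This is [A / (A + B) - A' / (A' + B') <= (1 - a) / (1 + a)] with denominators cleared. In terms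
    of the slacks [s] and [t] of the two comparison hypotheses, the difference of the sides is a sum
    of nonnegative terms. *)
Lemma mean_diff_le (R : realType) (a A B A' B' : R) :
  0 <= a <= 1 -> 0 <= A -> 0 <= B' -> a * A <= A' -> a * B' <= B ->
  (A * B' - A' * B) * (1 + a) <= (1 - a) * ((A + B) * (A' + B')).
Proof.
move=> /andP[a0 a1] A0 B0 hA hB.
have [s sE] : exists s, s = A' - a * A by eexists.
have [t tE] : exists t, t = B - a * B' by eexists.
have s0 : 0 <= s by lra.
have t0 : 0 <= t by lra.
have -> : A' = a * A + s by lra.
have -> : B = a * B' + t by lra.
rewrite -subr_ge0.
suff -> : (1 - a) * ((A + (a * B' + t)) * (a * A + s + B')) -
   (A * B' - (a * A + s) * (a * B' + t)) * (1 + a) =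
   (1 - a) * a * (A - B') ^+ 2 +
   (1 - a) * (A * s + a * (B' * s) + t * s + t * B' + a * (t * A)) +
   (1 + a) * (a * (A * t) + a * (s * B') + s * t).
  have a1' : 0 <= 1 - a by lra.
  have a2 : 0 <= 1 + a by lra.
  by do ![done | apply: addr_ge0 | apply: sqr_ge0 | apply: mulr_ge0].
ring.
Qed.

(** The values of [h] lie in an interval [m, m + L]. The weighted distances of [h] to the two ends,
    [A] and [B], sum to [L] times the total weight and inherit the comparison of the weights, so
    [mean_diff_le] applies to them. *)
Lemma weighted_mean_diff_le (R : realType) (U : finType) (u0 : U) (a L : R)
    (w w' h : U -> R) :
  0 <= a <= 1 -> (forall u, 0 < w u) -> (forall u, 0 < w' u) ->
  (forall u, a * w u <= w' u) -> (forall u, a * w' u <= w u) ->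
  (forall u v, `|h u - h v| <= L) ->
  (\sum_u w u * h u) / (\sum_u w u) - (\sum_u w' u * h u) / (\sum_u w' u)
    <= L * ((1 - a) / (1 + a)).
Proof.
move=> a01 w0 w'0 ww' w'w hL; have /andP[a0 a1] := a01.
have [m m_le m_ge] : exists2 m, forall u, m <= h u & forall u, h u <= m + L.
  exists (h [arg min_(u < u0) h u]%O); case: arg_minP => // v _ vmin u.
    exact: vmin.
  by have := hL u v; rewrite ler_norml => /andP[_]; lra.
have L0 : 0 <= L by have := m_le u0; have := m_ge u0; lra.
have sum_gt0 (k : U -> R) : (forall u, 0 < k u) -> 0 < \sum_u k u.
  move=> k0; rewrite (bigD1 u0) //=; apply: ltr_pwDl; rewrite ?sumr_ge0 //.
  by move=> u _; apply: ltW.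
have W0 := sum_gt0 _ w0; have W'0 := sum_gt0 _ w'0.
pose A (k : U -> R) := \sum_u k u * (h u - m).
pose B (k : U -> R) := \sum_u k u * (m + L - h u).
have ABE k : A k + B k = L * \sum_u k u.
  by rewrite mulr_sumr -big_split /=; apply: eq_bigr => u _; ring.
have AE k : \sum_u k u * h u = A k + m * \sum_u k u.
  by rewrite mulr_sumr -big_split /=; apply: eq_bigr => u _; ring.
have A_ge0 k : (forall u, 0 < k u) -> 0 <= A k.
  by move=> k0; apply: sumr_ge0 => u _; rewrite mulr_ge0 ?subr_ge0 // ltW.
have B_ge0 k : (forall u, 0 < k u) -> 0 <= B k.
  by move=> k0; apply: sumr_ge0 => u _; rewrite mulr_ge0 ?subr_ge0 // ltW.
have AA' : a * A w <= A w'.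
  rewrite mulr_sumr; apply: ler_sum => u _.
  by rewrite mulrA ler_wpM2r ?subr_ge0.
have BB' : a * B w' <= B w.
  rewrite mulr_sumr; apply: ler_sum => u _.
  by rewrite mulrA ler_wpM2r ?subr_ge0.
have := mean_diff_le a01 (A_ge0 _ w0) (B_ge0 _ w'0) AA' BB'.
rewrite !AE !ABE; set W := \sum_u w u in W0 *; set W' := \sum_u w' u in W'0 *.
have -> : (A w + m * W) / W - (A w' + m * W') / W' =
    (A w * W' - A w' * W) / (W * W').
  by field; rewrite !gt_eqF.
have -> : A w * B w' - A w' * B w = L * (A w * W' - A w' * W).
  have := ABE w; have := ABE w'; rewrite -/W -/W' => e1 e2.
  have -> : B w = L * W - A w by lra.
  have -> : B w' = L * W' - A w' by lra.
  ring.
have a10 : 0 < 1 + a by lra.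
rewrite ler_pdivrMr ?mulr_gt0 // (mulrC _ (W * W')) !mulrA ler_pdivlMr //.
(* The inequality at hand is the goal multiplied by [L]. For [L = 0] this factor cannot be
   cancelled, but then every [A] vanishes. *)
have [L_eq0 _|Lneq0 le] := eqVneq L 0; last first.
  have {Lneq0}Lgt0 : 0 < L by rewrite lt_neqAle eq_sym Lneq0.
  rewrite -(ler_pM2l Lgt0) mulrA (le_trans le) // le_eqVlt; apply/orP; left.
  by apply/eqP; ring.
have A0 k : (forall u, 0 < k u) -> A k = 0.
  move=> k0; have := ABE k; have := A_ge0 k k0; have := B_ge0 k k0.
  by rewrite L_eq0 mul0r; lra.
by rewrite !A0 // L_eq0 mulr0 !mul0r subr0 mul0r.
Qed.

Lemma weighted_mean_dist_le (R : realType) (U : finType) (u0 : U) (a L : R)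
    (w w' h : U -> R) :
  0 <= a <= 1 -> (forall u, 0 < w u) -> (forall u, 0 < w' u) ->
  (forall u, a * w u <= w' u) -> (forall u, a * w' u <= w u) ->
  (forall u v, `|h u - h v| <= L) ->
  `|(\sum_u w u * h u) / (\sum_u w u) - (\sum_u w' u * h u) / (\sum_u w' u)|
    <= L * ((1 - a) / (1 + a)).
Proof.
move=> a01 w0 w'0 ww' w'w hL; rewrite ler_norml lerNl opprB.
by rewrite !weighted_mean_diff_le.
Qed.

Lemma bernoulli_le (R : realType) (x : R) (n : nat) :
  0 <= x <= 1 -> 1 - n%:R * (1 - x) <= x ^+ n.
Proof.
move=> /andP[x0 x1]; elim: n => [|n IHn]; first by rewrite mul0r subr0 expr0.
rewrite exprS -natr1; have := exprn_ile1 n x0 x1; have := exprn_ge0 n x0.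
have n0 : 0 <= n%:R :> R by [].
by nra.
Qed.

(** * Shifts of flows *)

Lemma shiftD (G : multigraph) (q : nat) (o : {set edge G} -> edge G -> bool)
    (f : {ffun edge G -> 'Z_q}) (t u : 'Z_q) (C : {set edge G}) :
  shift o (shift o f t C) u C = shift o f (t + u) C.
Proof. by apply/ffunP=> e; rewrite !ffunE mulrDl addrA. Qed.

Lemma shiftAC (G : multigraph) (q : nat) (o : {set edge G} -> edge G -> bool)
    (f : {ffun edge G -> 'Z_q}) (t u : 'Z_q) (C D : {set edge G}) :
  shift o (shift o f t C) u D = shift o (shift o f u D) t C.
Proof. by apply/ffunP=> e; rewrite !ffunE addrAC. Qed.

Lemma shift_notin (G : multigraph) (q : nat)
    (o : {set edge G} -> edge G -> bool) (f : {ffun edge G -> 'Z_q}) (t : 'Z_q)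
    (C : {set edge G}) (e : edge G) :
  e \notin C -> shift o f t C e = f e.
Proof. by rewrite ffunE /chi => /negPf ->; rewrite mulr0 addr0. Qed.

Lemma shift_is_flow (G : multigraph) (q : nat)
    (o : {set edge G} -> edge G -> bool) (CC : {set {set edge G}})
    (f : {ffun edge G -> 'Z_q}) (t : 'Z_q) (C : {set edge G}) :
  even_generating_set q o CC -> C \in CC -> is_flow f ->
  is_flow (shift o f t C).
Proof.
move=> [_ gen] CCC /gen[c fE]; apply/gen.
exists (fun D => c D + (if D == C then t else 0)) => e.
rewrite ffunE fE; under [RHS]eq_bigr do rewrite mulrDl.
rewrite big_split /= (bigD1 C CCC) /= [X in _ = _ + X](bigD1 C CCC) /= eqxx.
rewrite [X in _ = _ + (_ + X)]big1 ?addr0 // => D /andP[_ /negPf ->].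
by rewrite mul0r.
Qed.

(** The default [f] of [insubd] is taken only when the shifted function is not a flow, which cannot
    happen for [C] in an even generating set. *)
Definition flow_shift (G : multigraph) (q : nat)
    (o : {set edge G} -> edge G -> bool) (f : flow G q) (t : 'Z_q)
    (C : {set edge G}) : flow G q :=
  insubd f (shift o (val f) t C).

Lemma val_flow_shift (G : multigraph) (q : nat)
    (o : {set edge G} -> edge G -> bool) (CC : {set {set edge G}})
    (f : flow G q) (t : 'Z_q) (C : {set edge G}) :
  even_generating_set q o CC -> C \in CC ->
  val (flow_shift o f t C) = shift o (val f) t C.
Proof.
by move=> gen CCC; apply: insubdK; apply: shift_is_flow gen CCC (valP f).
Qed.

Lemma flow_shift_diff (G : multigraph) (q : nat)
    (o : {set edge G} -> edge G -> bool) (CC : {set {set edge G}})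
    (f : flow G q) (t u : 'Z_q) (C : {set edge G}) :
  even_generating_set q o CC -> C \in CC ->
  flow_shift o f u C = flow_shift o (flow_shift o f t C) (u - t) C.
Proof.
move=> gen CCC; apply: val_inj.
by rewrite !(val_flow_shift _ _ gen CCC) shiftD addrC subrK.
Qed.

Lemma flow_shiftAC (G : multigraph) (q : nat)
    (o : {set edge G} -> edge G -> bool) (CC : {set {set edge G}})
    (f : flow G q) (t u : 'Z_q) (C D : {set edge G}) :
  even_generating_set q o CC -> C \in CC -> D \in CC ->
  flow_shift o (flow_shift o f t C) u D = flow_shift o (flow_shift o f u D) t C.
Proof.
move=> gen CCC DCC; apply: val_inj.
by rewrite !(val_flow_shift _ _ gen CCC, val_flow_shift _ _ gen DCC) shiftAC.
Qed.

(** * Positivity and normalisation of the weights *)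

Lemma flow_partition_function_gt0 (R : realType) (G : multigraph) (q : nat) (x : R) :
  0 < x -> 0 < \sum_(g : flow G q) x ^+ #|supp (val g)|.
Proof.
move=> x0; have zf : is_flow ([ffun=> 0] : {ffun edge G -> 'Z_q}).
  by apply/forallP => v; rewrite !big1 // => e _; rewrite ffunE.
pose z : flow G q := exist (fun f => is_flow f) _ zf.
rewrite (bigD1 z) //=; apply: ltr_pwDl; first exact: exprn_gt0.
by apply: sumr_ge0 => g _; rewrite exprn_ge0 // ltW.
Qed.

Lemma mu_flow_gt0 (R : realType) (G : multigraph) (q : nat) (x : R)
    (f : {ffun edge G -> 'Z_q}) : 0 < x -> 0 < mu_flow x f.
Proof.
by move=> x0; rewrite divr_gt0 ?exprn_gt0 ?flow_partition_function_gt0.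
Qed.

Lemma sum_mu_flow (R : realType) (G : multigraph) (q : nat) (x : R) :
  0 < x -> \sum_(f : flow G q) mu_flow x (val f) = 1.
Proof.
move=> x0; rewrite -mulr_suml divff //.
by rewrite gt_eqF ?flow_partition_function_gt0.
Qed.

Lemma sum_mu_shift_gt0 (R : realType) (G : multigraph) (q : nat)
    (o : {set edge G} -> edge G -> bool) (x : R) (f : {ffun edge G -> 'Z_q})
    (C : {set edge G}) :
  0 < x -> 0 < \sum_(u : 'Z_q) mu_flow x (shift o f u C).
Proof.
move=> x0; rewrite (bigD1 0) //=; apply: ltr_pwDl; first exact: mu_flow_gt0.
by apply: sumr_ge0 => u _; rewrite ltW ?mu_flow_gt0.
Qed.

Lemma sum_mu_shift (R : realType) (G : multigraph) (q : nat)
    (o : {set edge G} -> edge G -> bool) (x : R) (f : {ffun edge G -> 'Z_q})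
    (t : 'Z_q) (C : {set edge G}) :
  \sum_(u : 'Z_q) mu_flow x (shift o (shift o f t C) u C) =
  \sum_(u : 'Z_q) mu_flow x (shift o f u C).
Proof.
rewrite [RHS](reindex_inj (addrI t)).
by apply: eq_bigr => u _; rewrite shiftD.
Qed.

(** * Resampling along one subgraph, and reversibility *)

(** Expectation of [h] after a heat-bath update of [f] along [C]. *)
Definition resample_mean (R : realType) (G : multigraph) (q : nat)
    (o : {set edge G} -> edge G -> bool) (x : R) (h : flow G q -> R)
    (f : flow G q) (C : {set edge G}) : R :=
  (\sum_(u : 'Z_q) mu_flow x (shift o (val f) u C) * h (flow_shift o f u C)) /
  \sum_(u : 'Z_q) mu_flow x (shift o (val f) u C).

Lemma sum_flow_chain (R : realType) (G : multigraph) (q : nat)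
    (o : {set edge G} -> edge G -> bool) (CC : {set {set edge G}}) (x : R)
    (h : flow G q -> R) (f : flow G q) :
  even_generating_set q o CC ->
  \sum_g flow_chain o CC x f g * h g =
  (#|CC|%:R)^-1 * \sum_(C in CC) resample_mean o x h f C.
Proof.
move=> gen; rewrite /flow_chain.
under eq_bigr do rewrite -mulrA mulr_suml.
rewrite -mulr_sumr exchange_big /=; congr (_ * _); apply: eq_bigr => C CCC.
under eq_bigr do rewrite mulr_suml big_mkcond.
rewrite exchange_big /= /resample_mean mulr_suml; apply: eq_bigr => t _.
rewrite -big_mkcond /= (big_pred1 (flow_shift o f t C)) => [|g].
  by rewrite mulrAC.
by rewrite -(val_flow_shift _ _ gen CCC) /= eq_sym.
Qed.

(** A move by [t] along [C] is undone by the move by [- t], and both have the same normalising sum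
    because the two flows differ by a multiple of chi_C. *)
Lemma flow_chain_reversible (R : realType) (G : multigraph) (q : nat)
    (o : {set edge G} -> edge G -> bool) (CC : {set {set edge G}}) (x : R)
    (f g : flow G q) :
  mu_flow x (val f) * flow_chain o CC x f g =
  mu_flow x (val g) * flow_chain o CC x g f.
Proof.
rewrite /flow_chain mulrCA [RHS]mulrCA; congr (_ * _); rewrite !mulr_sumr.
apply: eq_bigr => C _; rewrite !mulr_sumr.
rewrite [RHS](reindex_inj oppr_inj) /=.
have shiftN (k k' : {ffun edge G -> 'Z_q}) t :
    (shift o k t C == k') -> k = shift o k' (- t) C.
  by move=> /eqP <-; rewrite shiftD subrr shift0.
apply: eq_big => [t|t fg].
  by apply/idP/idP => /shiftN ->; rewrite ?opprK.
have gE := shiftN _ _ _ fg.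
rewrite -gE (eqP fg) {2}gE sum_mu_shift.
by rewrite mulrCA.
Qed.

(** Detailed balance reduces the claim to row sums equal to 1, which are the one-step means of the
    constant function 1. *)
Lemma flow_chain_stationary (R : realType) (G : multigraph) (q : nat)
    (o : {set edge G} -> edge G -> bool) (CC : {set {set edge G}}) (x : R)
    (g : flow G q) :
  0 < x -> even_generating_set q o CC -> (0 < #|CC|)%N ->
  \sum_f mu_flow x (val f) * flow_chain o CC x f g = mu_flow x (val g).
Proof.
move=> x0 gen r0; under eq_bigr do rewrite flow_chain_reversible.
rewrite -mulr_sumr -[RHS]mulr1; congr (_ * _).
under eq_bigr do rewrite -[flow_chain _ _ _ _ _]mulr1.
rewrite (sum_flow_chain _ (fun=> 1) _ gen) (eq_bigr (fun=> 1)) => [|C _].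
  by rewrite sumr_const mulVf // pnatr_eq0 -lt0n.
rewrite /resample_mean; under eq_bigr do rewrite mulr1.
by rewrite divff // gt_eqF // sum_mu_shift_gt0.
Qed.

(** * One-step contraction of Lipschitz functions *)

Definition flow_lipschitz (R : realType) (G : multigraph) (q : nat)
    (o : {set edge G} -> edge G -> bool) (CC : {set {set edge G}}) (L : R)
    (h : flow G q -> R) : Prop :=
  forall f t C, C \in CC -> `|h f - h (flow_shift o f t C)| <= L.

Lemma resample_mean_shift (R : realType) (G : multigraph) (q : nat)
    (o : {set edge G} -> edge G -> bool) (CC : {set {set edge G}}) (x : R)
    (h : flow G q -> R) (f : flow G q) (t : 'Z_q) (C : {set edge G}) :
  even_generating_set q o CC -> C \in CC ->
  resample_mean o x h (flow_shift o f t C) C = resample_mean o x h f C.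
Proof.
move=> gen CCC; rewrite /resample_mean (val_flow_shift _ _ gen CCC) sum_mu_shift.
congr (_ / _); rewrite [RHS](reindex_inj (addrI t)); apply: eq_bigr => u _ /=.
by rewrite shiftD (flow_shift_diff f t (t + u) gen CCC) addrAC subrr add0r.
Qed.

(* The edges outside [C] contribute a factor independent of [u], which cancels. *)
Lemma resample_meanE (R : realType) (G : multigraph) (q : nat)
    (o : {set edge G} -> edge G -> bool) (x : R) (h : flow G q -> R)
    (f : flow G q) (C : {set edge G}) :
  0 < x ->
  let w u := x ^+ #|supp (shift o (val f) u C) :&: C| in
  resample_mean o x h f C =
  (\sum_(u : 'Z_q) w u * h (flow_shift o f u C)) / \sum_(u : 'Z_q) w u.
Proof.
move=> x0 w.
pose c := x ^+ #|supp (val f) :\: C| / \sum_(g : flow G q) x ^+ #|supp (val g)|.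
have muE u : mu_flow x (shift o (val f) u C) = c * w u.
  rewrite /mu_flow -(cardsID C (supp _)) exprD -mulrA mulrC /c.
  congr (_ / _ * _).
  congr (_ ^+ _); apply: eq_card => e; rewrite !inE.
  by case: (boolP (e \in C)) => //= eC; rewrite shift_notin.
have c0 : c != 0.
  have := mu_flow_gt0 (shift o (val f) 0 C) x0; rewrite muE => /gt_eqF.
  by apply: contraFneq => ->; rewrite mul0r.
rewrite /resample_mean; under eq_bigr do rewrite muE -mulrA.
under [X in _ / X]eq_bigr do rewrite muE.
by rewrite -!mulr_sumr -mulf_div divff // mul1r.
Qed.

(** Inside [D], a shift along [C] can enlarge the support only on [C :&: D]. Used for both [t] and
    [- t], this bounds the ratio of weights on [D] in both directions by a power of [x]. *)
Lemma supp_shift_le (G : multigraph) (q : nat)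
    (o : {set edge G} -> edge G -> bool) (f : {ffun edge G -> 'Z_q}) (t : 'Z_q)
    (C D : {set edge G}) :
  (#|supp (shift o f t C) :&: D| <= #|supp f :&: D| + #|C :&: D|)%N.
Proof.
apply: leq_trans (leq_card_setU _ _); apply/subset_leq_card/subsetP => e.
rewrite !inE => /andP[+ ->]; case: (boolP (e \in C)) => eC.
  by rewrite orbT.
by rewrite shift_notin // => ->.
Qed.

Lemma resample_mean_dist (R : realType) (G : multigraph) (q : nat)
    (o : {set edge G} -> edge G -> bool) (CC : {set {set edge G}}) (x L : R)
    (h : flow G q -> R) (f : flow G q) (t : 'Z_q) (C D : {set edge G}) :
  0 < x <= 1 -> even_generating_set q o CC -> C \in CC -> D \in CC ->
  flow_lipschitz o CC L h ->
  `|resample_mean o x h f D - resample_mean o x h (flow_shift o f t C) D| <=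
  L + L * ((1 - x ^+ #|C :&: D|) / (1 + x ^+ #|C :&: D|)).
Proof.
move=> /andP[x0 x1] gen CCC DCC Lh; rewrite !resample_meanE //=.
set w := fun u => x ^+ #|supp (shift o (val f) u D) :&: D|.
set w' := fun u => x ^+ #|supp (shift o (val (flow_shift o f t C)) u D) :&: D|.
set a := x ^+ _.
have a01 : 0 <= a <= 1 by rewrite exprn_ge0 ?exprn_ile1 // ltW.
have w0 u : 0 < w u by rewrite exprn_gt0.
have w'0 u : 0 < w' u by rewrite exprn_gt0.
have ww' u : a * w u <= w' u.
  rewrite /w /w' -exprD; apply: ler_wiXn2l => //; first exact: ltW.
  rewrite addnC (val_flow_shift _ _ gen CCC) shiftAC.
  exact: supp_shift_le.
have w'w u : a * w' u <= w u.
  rewrite /w /w' -exprD; apply: ler_wiXn2l => //; first exact: ltW.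
  rewrite addnC (val_flow_shift _ _ gen CCC) shiftAC.
  have {1}-> : shift o (val f) u D =
      shift o (shift o (shift o (val f) u D) t C) (- t) C.
    by rewrite shiftD subrr shift0.
  exact: supp_shift_le.
have osc u v : `|h (flow_shift o f u D) - h (flow_shift o f v D)| <= L.
  by rewrite (flow_shift_diff f u v gen DCC) Lh.
have W'0 : 0 < \sum_u w' u.
  rewrite (bigD1 0) //=; apply: ltr_pwDl => //.
  by apply: sumr_ge0 => u _; apply: ltW.
(* The intermediate mean [m] uses the weights of the shifted flow but the values of the unshifted
   one. Changing the weights costs the term with the ratio; changing the values costs at most [L],
   since shifts along [C] and [D] commute. *)
set m := (\sum_u w' u * h (flow_shift o f u D)) / \sum_u w' u.
rewrite -(subrKA m) addrC (le_trans (ler_normD _ _)) // lerD //; last first.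
  exact: weighted_mean_dist_le.
rewrite -mulrBl normrM [X in _ * X]gtr0_norm ?invr_gt0 // ler_pdivrMr //.
rewrite -sumrB mulr_sumr (le_trans (ler_norm_sum _ _ _)) //; apply: ler_sum => u _.
rewrite -mulrBr normrM gtr0_norm // mulrC; apply: ler_wpM2r; first exact: ltW.
by rewrite (flow_shiftAC _ _ _ gen CCC DCC) Lh.
Qed.

(** Among the choices of [D], the choice [C] contributes 0, each of the other [#|CC| - 1]
    contributes [L], and at most [d] of these, meeting [C], contribute an extra [L * tau]. Averaging
    gives the factor. *)
Lemma flow_chain_lipschitz (R : realType) (G : multigraph) (q d io : nat)
    (o : {set edge G} -> edge G -> bool) (CC : {set {set edge G}}) (x L : R)
    (h : flow G q -> R) :
  0 < x <= 1 -> even_generating_set q o CC -> 0 <= L ->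
  (gs_degree CC <= d)%N -> (gs_inter CC <= io)%N ->
  flow_lipschitz o CC L h ->
  flow_lipschitz o CC
    ((1 - (1 - d%:R * ((1 - x ^+ io) / (1 + x ^+ io))) / #|CC|%:R) * L)
    (fun f => \sum_g flow_chain o CC x f g * h g).
Proof.
move=> x01 gen L0 hdeg hinter Lh f t C CCC; have /andP[x0 x1] := x01.
have r0 : 0 < #|CC|%:R :> R by rewrite ltr0n; apply/card_gt0P; exists C.
rewrite !sum_flow_chain // -mulrBr -sumrB normrM gtr0_norm ?invr_gt0 //.
rewrite mulrC ler_pdivrMr //; set tau := (1 - x ^+ io) / _.
have tau0 : 0 <= tau.
  apply: divr_ge0; first by rewrite subr_ge0 exprn_ile1 // ltW.
  by rewrite addr_ge0 // exprn_ge0 // ltW.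
(* Intersections may be smaller than [io]; the cost grows with the exponent because [x <= 1]. *)
have tau_mono k : (k <= io)%N -> (1 - x ^+ k) / (1 + x ^+ k) <= tau.
  move=> kio; have : x ^+ io <= x ^+ k by rewrite ler_wiXn2l // ltW.
  have := exprn_gt0 io x0; have := exprn_gt0 k x0.
  move: (x ^+ k) (x ^+ io) @tau tau0 => a b tau _ a0 b0 ba.
  rewrite ler_pdivrMr ?addr_gt0 // /tau mulrAC ler_pdivlMr ?addr_gt0 //.
  by nra.
rewrite (le_trans (ler_norm_sum _ _ _)) // (bigD1 C) //=.
rewrite (resample_mean_shift _ _ _ _ gen CCC) subrr normr0 add0r.
apply: (@le_trans _ _ (\sum_(D in CC | D != C)
    (L + if C :&: D != set0 then L * tau else 0))).
  apply: ler_sum => D /andP[DCC DC].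
  apply: le_trans (resample_mean_dist _ _ x01 gen CCC DCC Lh) _.
  rewrite lerD2l; case: ifPn => [_|]; last first.
    by rewrite negbK => /eqP ->; rewrite cards0 expr0 subrr mul0r mulr0.
  apply: ler_wpM2l => //; apply: tau_mono; apply: leq_trans hinter.
  apply: leq_trans (leq_bigmax_cond C CCC).
  by apply: (leq_bigmax_cond D); rewrite DCC eq_sym.
rewrite big_split /= -big_mkcondr /= !sumr_const.
have -> : #|[pred D | (D \in CC) && (D != C)]| = (#|CC|.-1)%N.
  rewrite (cardsD1 C CC) CCC /=; apply: eq_card => D.
  by rewrite !inE andbC.
set m := (X in _ + L * tau *+ X).
have md : (m <= d)%N.
  apply: leq_trans hdeg; apply: leq_trans (leq_bigmax_cond C CCC).
  apply/subset_leq_card/subsetP => D; rewrite !inE.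
  by rewrite unfold_in => /andP[/andP[-> ->] ->].
have -> : (1 - (1 - d%:R * tau) / #|CC|%:R) * L * #|CC|%:R =
    L * (#|CC|%:R - 1) + L * tau * d%:R.
  by field; rewrite gt_eqF.
rewrite lerD //.
  rewrite -(mulr_natr L) ler_wpM2l // lerBrDr natr1 prednK //.
  by apply/card_gt0P; exists C.
rewrite -(mulr_natr _ m); apply: ler_wpM2l; first exact: mulr_ge0.
by rewrite ler_nat.
Qed.

Lemma nstep_flow_lipschitz (R : realType) (G : multigraph) (q d io n : nat)
    (o : {set edge G} -> edge G -> bool) (CC : {set {set edge G}}) (x L : R)
    (h : flow G q -> R) :
  0 < x <= 1 -> even_generating_set q o CC -> 0 <= L ->
  (gs_degree CC <= d)%N -> (gs_inter CC <= io)%N ->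
  let lambda := 1 - (1 - d%:R * ((1 - x ^+ io) / (1 + x ^+ io))) / #|CC|%:R in
  0 <= lambda -> flow_lipschitz o CC L h ->
  flow_lipschitz o CC (lambda ^+ n * L)
    (fun f => \sum_g nstep (flow_chain o CC x) n f g * h g).
Proof.
move=> x01 gen + hdeg hinter lambda la0.
(* [L] and [h] are generalised because the last step of the chain acts on [h] first; the induction
   hypothesis is then used for its one-step mean, with constant [lambda * L]. *)
elim: n L h => [|n IHn] L h L0 Lh f t C CCC.
  by rewrite !sum_nstep0 expr0 mul1r Lh.
rewrite !sum_nstepS exprSr -mulrA; apply: IHn => //; first exact: mulr_ge0.
exact: flow_chain_lipschitz.
Qed.

(** * Diameter and decay of the total variation distance *)

Lemma flow_lipschitz_diam (R : realType) (G : multigraph) (q : nat)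
    (o : {set edge G} -> edge G -> bool) (CC : {set {set edge G}}) (L : R)
    (h : flow G q -> R) (f g : flow G q) :
  even_generating_set q o CC -> flow_lipschitz o CC L h ->
  `|h f - h g| <= L * #|CC|%:R.
Proof.
move=> gen Lh.
(* The list [s] holds the subgraphs whose coefficients still have to be corrected on the way from
   [f'] to [g]; each correction is one shift. *)
have path (c : {set edge G} -> 'Z_q) (s : seq {set edge G}) :
    {subset s <= CC} -> forall f' : flow G q,
    (forall e, val g e = val f' e + \sum_(C <- s) c C * (chi C (o C) e)%:~R) ->
    `|h f' - h g| <= L * (size s)%:R.
  elim: s => [_ f' gE|C s IHs sCC f' gE].
    suff -> : g = f' by rewrite subrr normr0 mulr0.
    by apply/val_inj/ffunP => e; rewrite gE big_nil addr0.
  have CCC : C \in CC by apply: sCC; rewrite mem_head.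
  rewrite -(subrKA (h (flow_shift o f' (c C) C))) (le_trans (ler_normD _ _)) //.
  rewrite /= -add1n natrD mulrDr mulr1 lerD //; first exact: Lh.
  apply: IHs => [D Ds|e]; first by apply: sCC; rewrite inE Ds orbT.
  by rewrite (val_flow_shift _ _ gen CCC) ffunE gE big_cons addrA.
have [_ genP] := gen.
have [/genP[cf fE] /genP[cg gE]] := (valP f, valP g).
rewrite cardE; apply: (path (fun C => cg C - cf C)) => [C|e].
  by rewrite mem_enum.
rewrite big_enum /=; under [X in _ + X]eq_bigr do rewrite mulrBl.
by rewrite sumrB -fE -gE addrC subrK.
Qed.

Lemma flow_tv_dist_le1 (R : realType) (G : multigraph) (q : nat)
    (o : {set edge G} -> edge G -> bool) (CC : {set {set edge G}}) (x : R)
    (f : flow G q) :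
  0 < x ->
  tv_dist (nstep (flow_chain o CC x) 0 f) (fun g => mu_flow x (val g)) <= 1.
Proof.
move=> x0; apply: tv_dist_le_of_osc.
- by move=> g; rewrite ltW ?mu_flow_gt0.
- exact: sum_mu_flow.
- exact: (nstep0_stationary _ (fun g : flow G q => mu_flow x (val g))).
- by move=> h h1 g k; rewrite !sum_nstep0.
Qed.

(** A test function of oscillation 1 is 1-Lipschitz, so its [n]-step mean is
    [lambda ^+ n]-Lipschitz, and the diameter bound applies. For empty [CC] the kernel is
    identically 0, as [0^-1 = 0], hence the restriction to [n = 0] in that case. *)
Lemma flow_tv_dist_le (R : realType) (G : multigraph) (q d io n : nat)
    (o : {set edge G} -> edge G -> bool) (CC : {set {set edge G}}) (x : R)
    (f : flow G q) :
  0 < x <= 1 -> even_generating_set q o CC -> (n == 0)%N || (0 < #|CC|)%N ->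
  (gs_degree CC <= d)%N -> (gs_inter CC <= io)%N ->
  let lambda := 1 - (1 - d%:R * ((1 - x ^+ io) / (1 + x ^+ io))) / #|CC|%:R in
  0 <= lambda ->
  tv_dist (nstep (flow_chain o CC x) n f) (fun g => mu_flow x (val g)) <=
  lambda ^+ n * #|CC|%:R.
Proof.
move=> x01 gen nr hdeg hinter lambda la0; have /andP[x0 _] := x01.
apply: tv_dist_le_of_osc.
- by move=> g; rewrite ltW ?mu_flow_gt0.
- exact: sum_mu_flow.
- move=> g; pose mu (k : flow G q) := mu_flow x (val k).
  case/orP: nr => [/eqP ->|r0]; first exact: (nstep0_stationary _ mu).
  by apply: (@nstep_stationary _ _ _ mu) => k; apply: flow_chain_stationary.
- move=> h h1 g k; rewrite -[X in X * _]mulr1.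
  apply: (flow_lipschitz_diam 
    (h := fun f' => \sum_g' nstep (flow_chain o CC x) n f' g' * h g') _ _ gen).
  apply: (nstep_flow_lipschitz n x01 gen ler01 hdeg hinter la0) => k' t C _.
  exact: h1.
Qed.

(* Bernoulli gives [x ^+ io >= 1 - 2 y] with [y = io (1 - x) / 2], so the total
   variation distance is at most [y / (1 - y)], which is [1 / d] exactly at the
   critical value [y = 1 / (d + 1)]. *)
Lemma contraction_gap (R : realType) (d io : nat) (x : R) :
  (0 < d)%N -> (0 < io)%N -> 0 < x < 1 -> 1 - 2 / ((d%:R + 1) * io%:R) < x ->
  (d%:R + 1) * io%:R / 2 * (x - (1 - 2 / ((d%:R + 1) * io%:R))) <=
  1 - d%:R * ((1 - x ^+ io) / (1 + x ^+ io)).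
Proof.
move=> d0 io0 /andP[x0 x1] hx.
have dR : 1 <= d%:R :> R by rewrite ler1n.
have ioR : 1 <= io%:R :> R by rewrite ler1n.
have bern : 1 - io%:R * (1 - x) <= x ^+ io.
  by apply: bernoulli_le; rewrite !ltW.
have a0 := exprn_gt0 io x0.
have -> : (d%:R + 1) * io%:R / 2 * (x - (1 - 2 / ((d%:R + 1) * io%:R))) =
    1 - (d%:R + 1) * (io%:R * (1 - x) / 2).
  by field; apply/andP; split; apply/eqP; lra.
have y0 : 0 <= io%:R * (1 - x) / 2 by rewrite divr_ge0 ?mulr_ge0 // subr_ge0 ltW.
have hy : (d%:R + 1) * (io%:R * (1 - x) / 2) < 1.
  have c0 : 0 < (d%:R + 1) * io%:R :> R by rewrite mulr_gt0 //; lra.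
  move: hx; rewrite ltrBlDl -ltrBlDr ltr_pdivlMr //; lra.
have yE : io%:R * (1 - x) = 2 * (io%:R * (1 - x) / 2) by field.
move: bern y0 hy; rewrite {1}yE; move: (io%:R * (1 - x) / 2) => y bern y0 hy.
have d10 : 0 < 1 + x ^+ io by lra.
move: (x ^+ io) a0 bern d10 => a a0 bern d10.
rewrite -subr_ge0.
have -> : 1 - d%:R * ((1 - a) / (1 + a)) - (1 - (d%:R + 1) * y) =
   ((d%:R + 1) * y * (1 + a) - d%:R * (1 - a)) / (1 + a).
  by field; apply/eqP; lra.
apply: divr_ge0; last lra.
(* A nonnegative combination of the slack in Bernoulli's inequality and the slack in
   [y < 1 / (d + 1)]. *)
have -> : (d%:R + 1) * y * (1 + a) - d%:R * (1 - a) =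
    ((d%:R + 1) * y + d%:R) * (a - (1 - 2 * y)) + 2 * (y * (1 - (d%:R + 1) * y)).
  by ring.
have d10' : 0 <= d%:R + 1 :> R by lra.
have gap0 : 0 <= 1 - (d%:R + 1) * y by lra.
have bern0 : 0 <= a - (1 - 2 * y) by lra.
by do ![done | apply: addr_ge0 | apply: mulr_ge0].
Qed.

(** * Mixing times and logarithmic estimates *)

Lemma is_mixing_time_exists (R : realType) (T : finType) (P : T -> T -> R)
    (pi : T -> R) (delta : R) (n : nat) :
  mixed P pi delta n ->
  exists2 t, is_mixing_time P pi delta t & (t <= n)%N.
Proof.
pose mixedb m := [forall a, tv_dist (nstep P m a) pi <= delta].
have mixedP m : reflect (mixed P pi delta m) (mixedb m) by apply: forallP.
move=> mn; have ex : exists m, mixedb m by exists n; apply/mixedP.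
exists (ex_minn ex); case: ex_minnP => t /mixedP mt tmin.
  by split=> // m /mixedP; apply: tmin.
by apply: tmin; apply/mixedP.
Qed.

(** From [1 - b <= expR (- b)], the power is at most [expR (- b * n)], which is at most [delta / r]
    for such [n]. *)
Lemma exp_decay_le (R : realType) (b delta r : R) (n : nat) :
  0 < b <= 1 -> 0 < delta -> 0 < r -> ln (r / delta) / b <= n%:R ->
  (1 - b) ^+ n * r <= delta.
Proof.
move=> /andP[b0 b1] delta0 r0; rewrite ler_pdivrMr // => hn.
apply: (@le_trans _ _ (expR (- ln (r / delta)) * r)).
  apply: ler_wpM2r; first exact: ltW.
  apply: (@le_trans _ _ (expR (- b) ^+ n)).
    apply: lerXn2r; rewrite ?nnegrE ?subr_ge0 ?expR_ge0 //.
    exact: expR_ge1Dx.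
  by rewrite -expRM_natl ler_expR; lra.
rewrite expRN lnK ?posrE ?divr_gt0 // invf_div mulfVK // gt_eqF //.
Qed.

(** Apply [ln z <= z - 1] to [z = y^-1]. *)
Lemma ln_ge_half (R : realType) (y : R) : 2 <= y -> 2^-1 <= ln y.
Proof.
move=> y2; have y0 : 0 < y by lra.
have yV : y^-1 <= 2^-1 by rewrite lef_pV2 ?posrE.
have : ln (1 + (y^-1 - 1)) <= y^-1 - 1.
  by apply: le_ln1Dx; rewrite ltrDr invr_gt0.
by rewrite addrC subrK lnV ?posrE //; lra.
Qed.

(** The formula is negative for [delta > r > 0], and it can lie below 1 although one step is needed,
    as for a single loop with [q] large and [delta] just below 1. Hence a bound by the formula under
    conditions, and one by its maximum with 1. *)
Theorem theorem3p2 (R : realType) (q d io : nat) (x xi delta : R)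
    (hq : (2 <= q)%N) (hd : (2 <= d)%N) (hio : (1 <= io)%N)
    (hx1 : x < 1) (hx : 1 - 2 / ((d%:R + 1) * io%:R) < x)
    (hxi : xi = x - (1 - 2 / ((d%:R + 1) * io%:R)))
    (hdelta : 0 < delta)
    (G : multigraph) (o : {set edge G} -> edge G -> bool)
    (CC : {set {set edge G}}) (r : nat)
    (ho : forall C, C \in CC -> eulerian_orientation C (o C))
    (hCC : even_generating_set q o CC)
    (hr : #|CC| = r)
    (hdeg : (gs_degree CC <= d)%N) (hinter : (gs_inter CC <= io)%N) :
  exists tmix : nat,
    [/\ flow_mixing_time q o CC x delta tmix,
        delta <= r%:R -> (2 <= r)%N \/ delta <= 1 / 2 ->
          tmix%:R <= 4 * r%:R / (d%:R * io%:R) * ln (r%:R * delta^-1) * xi^-1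
      & tmix%:R <=
          Num.max 1 (4 * r%:R / (d%:R * io%:R) * ln (r%:R * delta^-1) * xi^-1)].
Proof.
have dR : 2 <= d%:R :> R by rewrite ler_nat.
have ioR : 1 <= io%:R :> R by rewrite ler1n.
pose c : R := (d%:R + 1) * io%:R.
(* As [d >= 2], the threshold [1 - 2 / c] is at least 1/3, which makes [x] positive. *)
have c3 : 3 <= c by rewrite /c; nra.
have c2 : 2 / c <= 2 / 3 by rewrite ler_wpM2l // lef_pV2 ?posrE //; lra.
have x0 : 0 < x by move: hx; rewrite -/c; lra.
have x01 : 0 < x <= 1 by rewrite x0 ltW.
have xi0 : 0 < xi by rewrite hxi subr_gt0.
have gap : c / 2 * xi <= 1 - d%:R * ((1 - x ^+ io) / (1 + x ^+ io)).
  by rewrite hxi; apply: contraction_gap; rewrite ?x0 ?hx1 // (leq_trans _ hd).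
have cxi : c / 2 * xi <= 1.
  rewrite hxi -/c.
  have -> : c / 2 * (x - (1 - 2 / c)) = 1 - c / 2 * (1 - x).
    by field; apply/eqP; lra.
  by rewrite gerBl mulr_ge0 //; lra.
set B := 4 * _ / _ * _ * _.
have tv1 : 1 <= delta ->
    mixed (@flow_chain R G q o CC x) (fun f => mu_flow x (val f)) delta 0.
  by move=> d1 f; apply: le_trans d1; apply: flow_tv_dist_le1.
(* Without generators the zero flow is the only flow: the chain is mixed at time 0, and [B = 0]. *)
have [r0|r0] := posnP r.
  have m0 : mixed (@flow_chain R G q o CC x) (fun f => mu_flow x (val f)) delta 0.
    move=> f; have la0 : 0 <= 1 - (1 - d%:R * ((1 - x ^+ io) / (1 + x ^+ io))) / #|CC|%:R :> R.
      by rewrite hr r0 invr0 mulr0 subr0.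
    apply: le_trans (flow_tv_dist_le (n := 0) f x01 hCC _ hdeg hinter la0) _ => //.
    by rewrite hr r0 mulr0 ltW.
  have [t mt] := is_mixing_time_exists m0; rewrite leqn0 => /eqP tE.
  have B0 : B = 0 by rewrite /B r0 mulr0 !mul0r.
  by exists t; split=> //; rewrite tE ?B0 // le_max ler01.
have rR : 1 <= r%:R :> R by rewrite ler1n.
have BE : B = (4 * r%:R / (d%:R * io%:R) / xi) * ln (r%:R / delta).
  by rewrite /B mulrAC.
have coef0 : 0 <= 4 * r%:R / (d%:R * io%:R) / xi.
  by do ![done | exact: ltW | apply: mulr_ge0 | rewrite invr_ge0].
have [d1|d1] := leP 1 delta.
  have [t mt] := is_mixing_time_exists (tv1 d1); rewrite leqn0 => /eqP tE.
  exists t; split=> //; rewrite tE; last by rewrite le_max ler01.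
  by move=> dr _; rewrite BE mulr_ge0 // ln_ge0 // ler_pdivlMr ?mul1r.
have ln0 : 0 < ln (r%:R / delta).
  by rewrite ln_gt0 // ltr_pdivlMr // mul1r; lra.
(* [b] is the contraction guaranteed per step, and [A] below is the real number of steps that
   suffices. *)
pose b := c / 2 * xi / r%:R.
have b01 : 0 < b <= 1.
  rewrite /b divr_gt0 ?ler_pdivrMr ?mulr_gt0 //; lra.
have /andP[b0 b1] := b01.
pose A := ln (r%:R / delta) / b.
have A0 : 0 < A by rewrite divr_gt0.
(* The bound is at least twice what contraction requires, since [d * io <= c]; the spare factor 2
   pays for rounding [A] up. *)
have AB : 2 * A <= B.
  have -> : 2 * A = (4 * r%:R / c / xi) * ln (r%:R / delta).
    by rewrite /A /b; field; rewrite !gt_eqF //; lra.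
  rewrite BE; apply: ler_wpM2r; first exact: ltW.
  apply: ler_wpM2r; first by rewrite invr_ge0 ltW.
  apply: ler_wpM2l; first by rewrite mulr_ge0.
  by rewrite lef_pV2 ?posrE ?mulr_gt0 /c //; nra.
have B2r : 2 * r%:R * ln (r%:R / delta) <= B.
  apply: le_trans AB; rewrite /A /b mulrA ler_pdivlMr //.
  have -> : 2 * r%:R * ln (r%:R / delta) * (c / 2 * xi / r%:R) =
     2 * ln (r%:R / delta) * (c / 2 * xi).
    by field; rewrite gt_eqF //; lra.
  by rewrite -[leRHS]mulr1; apply: ler_wpM2l => //; rewrite mulr_ge0 // ltW.
have An := truncn_itv (ltW A0); set n := Num.truncn A in An.
have mn : mixed (@flow_chain R G q o CC x) (fun f => mu_flow x (val f)) delta n.+1.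
  move=> f; set la := 1 - (1 - d%:R * ((1 - x ^+ io) / (1 + x ^+ io))) / #|CC|%:R.
  have tau0 : 0 <= d%:R * ((1 - x ^+ io) / (1 + x ^+ io)).
    rewrite mulr_ge0 // divr_ge0 ?subr_ge0 ?exprn_ile1 ?addr_ge0 ?exprn_ge0 //; exact: ltW.
  have la0 : 0 <= la.
    by rewrite /la hr subr_ge0 ler_pdivrMr //; lra.
  have lab : la <= 1 - b.
    rewrite /la hr lerD2l lerN2 /b ler_pM2r // invr_gt0; lra.
  apply: le_trans (flow_tv_dist_le f x01 hCC _ hdeg hinter la0) _.
    by rewrite hr r0.
  rewrite -/la; clearbody la; rewrite hr.
  apply: (@le_trans _ _ ((1 - b) ^+ n.+1 * r%:R)).
    apply: ler_wpM2r => //; by apply: lerXn2r => //; rewrite nnegrE subr_ge0.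
  by apply: exp_decay_le => //; [lra | case/andP: An => _ /ltW].
have [t mt tn] := is_mixing_time_exists mn.
have tA : t%:R <= A + 1.
  apply: (@le_trans _ _ (n.+1%:R)); first by rewrite ler_nat.
  by rewrite -natr1 lerD2r; case/andP: An.
(* If [A >= 1], then [t <= A + 1 <= 2 * A <= B]. Otherwise [n = 0], so [t <= 1]. *)
have tB : 1 <= B -> t%:R <= B.
  have [A1 _|A1 B1] := leP 1 A; first lra.
  apply: le_trans B1; rewrite -[leRHS]/(1%:R) ler_nat (leq_trans tn) //.
  by rewrite ltnS leqNgt /n truncn_gt0 -ltNge.
exists t; split=> //.
  move=> dr cond; apply: tB; apply: le_trans B2r.
  (* Either condition gives [r / delta >= 2], so [2 * r * ln (r / delta) >= r >= 1]. *)
  have ln2 : 2^-1 <= ln (r%:R / delta).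
    apply: ln_ge_half; rewrite ler_pdivlMr //.
    case: cond => [r2|]; last lra.
    have : 2 <= r%:R :> R by rewrite ler_nat.
    lra.
  nra.
(* If [B < 1], then [A < 1] by [AB], so [n = 0] and a single step suffices. *)
rewrite le_max; have [B1|B1] := leP 1 B; first by rewrite tB ?orbT.
apply/orP; left; rewrite -[leRHS]/(1%:R) ler_nat (leq_trans tn) //.
by rewrite ltnS leqNgt /n truncn_gt0 -ltNge; lra.
Qed.
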